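(* Let $\mathsf C$ be a De Morgan clone with $\mathsf{DMA}\subseteq\mathsf C$. Then: (i) some function of $\mathsf C$ fails to preserve $\mathrm{B}_2$ iff $\mathsf C$ contains the constant $\mathsf n$ or the constant $\mathsf b$; (ii) some function of $\mathsf C$ fails to preserve $\mathrm{K}_3$ iff $\mathsf C$ contains $\mathsf b$ or $\mathrm{id}_{\mathsf n\mapsto\mathsf b}$ or $\partial$; (iii) some function of $\mathsf C$ fails to preserve $\mathrm{P}_3$ iff $\mathsf C$ contains $\mathsf n$ or $\mathrm{id}_{\mathsf b\mapsto\mathsf n}$ or $\partial$.
   Context: Let $\mathrm{DM}_4=\{\mathsf t,\mathsf f,\mathsf n,\mathsf b\}$. The truth order $\le$ has $\mathsf f$ least, $\mathsf t$ greatest, $\mathsf n,\mathsf b$ incomparable; $\wedge,\vee$ are its meet and join. De Morgan negation: $-\mathsf t=\mathsf f$, $-\mathsf f=\mathsf t$, $-\mathsf n=\mathsf n$, $-\mathsf b=\mathsf b$. Conflation: $\partial\mathsf t=\mathsf t$, $\partial\mathsf f=\mathsf f$, $\partial\mathsf n=\mathsf b$, $\partial\mathsf b=\mathsf n$. $\mathrm{id}_{\mathsf b\mapsto\mathsf n}$ maps $\mathsf b$ to $\mathsf n$ and fixes the other elements; $\mathrm{id}_{\mathsf n\mapsto\mathsf b}$ maps $\mathsf n$ to $\mathsf b$ and fixes the other elements. A De Morgan function is a map $\mathrm{DM}_4^n\to\mathrm{DM}_4$, $n\ge1$; a De Morgan clone is a set of such functions closed under composition and containing all projections; constants are unary constant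 functions. $\mathsf{DMA}$ is the clone generated by $\wedge,\vee,\mathsf t,\mathsf f,-$. $f$ preserves $X\subseteq\mathrm{DM}_4$ if arguments in $X$ give values in $X$. $\mathrm{B}_2=\{\mathsf t,\mathsf f\}$, $\mathrm{K}_3=\{\mathsf t,\mathsf n,\mathsf f\}$, $\mathrm{P}_3=\{\mathsf t,\mathsf b,\mathsf f\}$. *)

(* Defs.v *)
From HB Require Import structures.
From mathcomp Require Import all_boot all_order.

Set Implicit Arguments.
Unset Strict Implicit.
Unset Printing Implicit Defensive.

Import Order.TTheory.
Local Open Scope order_scope.

Inductive DM4 : predArgType := DMt | DMf | DMn | DMb.

Definition DM4_encode (x : DM4) : bool * bool :=
  match x with
  | DMt => (true, false) | DMf => (false, true)
  | DMn => (false, false) | DMb => (true, true)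
  end.

Definition DM4_decode (p : bool * bool) : DM4 :=
  match p with
  | (true, false) => DMt | (false, true) => DMf
  | (false, false) => DMn | (true, true) => DMb
  end.

Lemma DM4_encodeK : cancel DM4_encode DM4_decode.
Proof. by case. Qed.

HB.instance Definition _ := Finite.copy DM4 (can_type DM4_encodeK).

(* The truth order: f is least, t is greatest, n and b are incomparable. *)
Definition DM4_le (x y : DM4) : bool := [|| x == DMf, y == DMt | x == y].

Definition DM4_meet (x y : DM4) : DM4 :=
  match x, y with
  | DMt, z | z, DMt => z
  | DMn, DMn => DMn
  | DMb, DMb => DMb
  | _, _ => DMf
  end.

Definition DM4_join (x y : DM4) : DM4 :=
  match x, y with
  | DMf, z | z, DMf => z
  | DMn, DMn => DMn
  | DMb, DMb => DMb
  | _, _ => DMt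
  end.

Lemma DM4_le_refl : reflexive DM4_le. Proof. by case. Qed.
Lemma DM4_le_anti : antisymmetric DM4_le. Proof. by do 2!case. Qed.
Lemma DM4_le_trans : transitive DM4_le. Proof. by do 3!case. Qed.

Fact DM4_display : Order.disp_t. Proof. exact: Order.Disp tt tt. Qed.

HB.instance Definition _ := Order.Le_isPOrder.Build DM4_display DM4
  DM4_le_refl DM4_le_anti DM4_le_trans.

Lemma DM4_lexI (x y z : DM4) : (x <= DM4_meet y z) = (x <= y) && (x <= z).
Proof. by move: x y z; do 3!case. Qed.
Lemma DM4_leUx (x y z : DM4) : (DM4_join x y <= z) = (x <= z) && (y <= z).
Proof. by move: x y z; do 3!case. Qed.

HB.instance Definition _ :=
  Order.POrder_MeetJoin_isLattice.Build DM4_display DM4 DM4_lexI DM4_leUx.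

Lemma DM4_le0x (x : DM4) : DMf <= x. Proof. by case: x. Qed.
Lemma DM4_lex1 (x : DM4) : x <= DMt. Proof. by case: x. Qed.

HB.instance Definition _ := Order.hasBottom.Build DM4_display DM4 DM4_le0x.
HB.instance Definition _ := Order.hasTop.Build DM4_display DM4 DM4_lex1.

Definition DM4_neg (x : DM4) : DM4 :=
  match x with DMt => DMf | DMf => DMt | DMn => DMn | DMb => DMb end.

Definition conflation (x : DM4) : DM4 :=
  match x with DMt => DMt | DMf => DMf | DMn => DMb | DMb => DMn end.

Definition id_b_to_n (x : DM4) : DM4 := if x == DMb then DMn else x.
Definition id_n_to_b (x : DM4) : DM4 := if x == DMn then DMb else x.

Definition B2 : {set DM4} := [set DMt; DMf].
Definition K3 : {set DM4} := [set DMt; DMn; DMf].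
Definition P3 : {set DM4} := [set DMt; DMb; DMf].

(* [dmfun n] has arity [n.+1], so that there are no nullary functions: unary
   functions are in [dmfun 0] and binary ones in [dmfun 1]. *)
Definition dmfun (n : nat) := {ffun n.+1.-tuple DM4 -> DM4}.

Definition dmproj n (i : 'I_n.+1) : dmfun n := [ffun x => tnth x i].

Definition dmcomp m n (f : dmfun m) (g : 'I_m.+1 -> dmfun n) : dmfun n :=
  [ffun x => f [tuple g i x | i < m.+1]].

Definition dmfun1 (h : DM4 -> DM4) : dmfun 0 := [ffun x => h (tnth x ord0)].

Definition dmfun2 (h : DM4 -> DM4 -> DM4) : dmfun 1 :=
  [ffun x => h (tnth x ord0) (tnth x ord_max)].

Definition dmconst (c : DM4) : dmfun 0 := dmfun1 (fun=> c).

Definition dmset := forall n, dmfun n -> Prop.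

Definition dmset_sub (C D : dmset) : Prop := forall n (f : dmfun n), C n f -> D n f.

Record is_clone (C : dmset) : Prop := IsClone {
  clone_proj : forall n (i : 'I_n.+1), C n (dmproj i);
  clone_comp : forall m n (f : dmfun m) (g : 'I_m.+1 -> dmfun n),
    C m f -> (forall i, C n (g i)) -> C n (dmcomp f g)
}.

Definition generated_clone (G : dmset) : dmset := fun n f =>
  forall D : dmset, is_clone D -> dmset_sub G D -> D n f.

Inductive DMA_generator : dmset :=
  | DMA_meet : DMA_generator (dmfun2 Order.meet)
  | DMA_join : DMA_generator (dmfun2 Order.join)
  | DMA_t : DMA_generator (dmconst DMt)
  | DMA_f : DMA_generator (dmconst DMf)
  | DMA_neg : DMA_generator (dmfun1 DM4_neg).

Definition DMA : dmset := generated_clone DMA_generator.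

Definition preserves n (f : dmfun n) (X : {set DM4}) : Prop :=
  forall x : n.+1.-tuple DM4, (forall i, tnth x i \in X) -> f x \in X.

(* Main.v *)
Require Import Defs.
From mathcomp Require Import all_boot all_order.

(** Suppose [f] in [C] maps a tuple over [X] outside [X]. For [X = B2],
   substituting constants into [f] gives the constant [n] or [b]. For
   [X = {t, c, f}] with [c] one of [n], [b] and [d] the other one, substituting
   the identity for [c] and constants for [t] and [f] gives a unary [h] in [C]
   with [h c = d]. If [h t] or [h f] is [n] or [b], composing with constants
   shows that the constant [d] is in [C]. Otherwise [k = h \/ -h] fixes [t] and
   maps [f] to [t] and [c] to [d], and [(k /\ x) \/ -k] is the identity on
   [B2] and maps [c] to [d]: it is [conflation] if [h d = c], and otherwise the
   map sending [c] to [d] and fixing the rest. *)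

(** There are finitely many tuples over [DM4], so a boolean search finds the counterexample without
    classical logic. *)
Lemma not_preservesP n (f : dmfun n) (X : {set DM4}) :
  ~ preserves f X <->
  exists2 x : n.+1.-tuple DM4, (forall i, tnth x i \in X) & f x \notin X.
Proof.
split=> [nfX | [x xX /negP fxX] fX]; last exact/fxX/fX.
have [/existsP[x /andP[/forallP xX fxX]] | /existsPn nex] :=
  boolP [exists x : n.+1.-tuple DM4,
    [forall i, tnth x i \in X] && (f x \notin X)]; first by exists x.
case: nfX => x xX; have := nex x; rewrite negb_and negbK.
by case/orP=> // /forallP; case.
Qed.

Section CloneAboveDMA.

Variables (C : dmset) (C_clone : is_clone C) (DMA_sub_C : dmset_sub DMA C).

Set Implicit Arguments.
Unset Strict Implicit.
Unset Printing Implicit Defensive.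

Let in_C (h : DM4 -> DM4) := C 0 (dmfun1 h).

Lemma generator_in_C n (f : dmfun n) : DMA_generator f -> C n f.
Proof. by move=> Gf; apply: DMA_sub_C => D _; apply. Qed.

Lemma eq_in_C h1 h2 : h1 =1 h2 -> in_C h1 -> in_C h2.
Proof.
move=> eq_h; rewrite /in_C; suff -> : dmfun1 h1 = dmfun1 h2 by [].
by apply/ffunP=> x; rewrite !ffunE.
Qed.

Lemma in_C_subst n (f : dmfun n) (u : 'I_n.+1 -> DM4 -> DM4) :
  C n f -> (forall i, in_C (u i)) -> in_C (fun y => f [tuple u i y | i < n.+1]).
Proof.
move=> Cf Cu; have := clone_comp C_clone Cf Cu; rewrite /in_C.
congr (C 0 _); apply/ffunP=> x; rewrite !ffunE.
by congr (f _); apply: eq_from_tnth => i; rewrite !tnth_mktuple ffunE.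
Qed.

Lemma in_C_comp h1 h2 : in_C h1 -> in_C h2 -> in_C (h1 \o h2).
Proof.
move=> Ch1 Ch2; apply: eq_in_C (in_C_subst Ch1 (fun=> Ch2)) => y.
by rewrite ffunE tnth_mktuple.
Qed.

Lemma in_C_comp2 op h1 h2 :
  C 1 (dmfun2 op) -> in_C h1 -> in_C h2 -> in_C (fun y => op (h1 y) (h2 y)).
Proof.
move=> Cop Ch1 Ch2; pose u (i : 'I_2) := if i == ord0 then h1 else h2.
have Cu i : in_C (u i) by rewrite /u; case: ifP.
by apply: eq_in_C (in_C_subst Cop Cu) => y; rewrite ffunE !tnth_mktuple.
Qed.

Lemma in_C_meet h1 h2 :
  in_C h1 -> in_C h2 -> in_C (fun y => DM4_meet (h1 y) (h2 y)).
Proof. exact/in_C_comp2/generator_in_C/DMA_meet. Qed.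

Lemma in_C_join h1 h2 :
  in_C h1 -> in_C h2 -> in_C (fun y => DM4_join (h1 y) (h2 y)).
Proof. exact/in_C_comp2/generator_in_C/DMA_join. Qed.

Lemma in_C_neg h : in_C h -> in_C (fun y => DM4_neg (h y)).
Proof. exact/in_C_comp/generator_in_C/DMA_neg. Qed.

Lemma in_C_id : in_C id.
Proof.
have := clone_proj C_clone (ord0 : 'I_1); rewrite /in_C.
by congr (C 0 _); apply/ffunP=> x; rewrite !ffunE.
Qed.

Lemma in_C_constB2 a : a \in B2 -> in_C (fun=> a).
Proof.
by rewrite !inE => /orP[] /eqP ->; apply: generator_in_C; constructor.
Qed.

Lemma unary_not_preserves (X : {set DM4}) h c :
    in_C h -> c \in X -> h c \notin X ->
  exists n (f : dmfun n), C n f /\ ~ preserves f X.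
Proof.
move=> Ch cX hcX; exists 0, (dmfun1 h); split=> //; apply/not_preservesP.
by exists [tuple c] => [i|]; rewrite ?ffunE // (tnth_nth c) ord1.
Qed.

(** Each entry [a] of a counterexample to preservation is replaced by the unary map [u a];
    evaluating at [c] restores the counterexample. *)
Lemma not_preserves_unary (X : {set DM4}) (u : DM4 -> DM4 -> DM4) c :
    (forall a, a \in X -> in_C (u a)) -> (forall a, u a c = a) ->
    (exists n (f : dmfun n), C n f /\ ~ preserves f X) ->
  exists2 h, in_C h & h c \notin X.
Proof.
move=> Cu uc [n [f [Cf /not_preservesP[x xX fxX]]]].
exists (fun y => f [tuple u (tnth x i) y | i < n.+1]).
  by apply: in_C_subst => // i; apply/Cu/xX.
suff -> : [tuple u (tnth x i) c | i < n.+1] = x by [].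
by apply: eq_from_tnth => i; rewrite tnth_mktuple uc.
Qed.

Lemma not_preserves_B2 :
  (exists n (f : dmfun n), C n f /\ ~ preserves f B2) <->
  (in_C (fun=> DMn) \/ in_C (fun=> DMb)).
Proof.
split=> [|[] Ch].
(* Only constants are substituted, so any point serves as [c]. Composing with the constant [DMt]
   then gives the constant [h DMt]. *)
- move=> /(not_preserves_unary (u := fun a _ => a) (c := DMt) in_C_constB2).
  case=> // h Ch; have tB2 : DMt \in B2 by rewrite !inE.
  have := in_C_comp Ch (in_C_constB2 tB2); rewrite /comp.
  by case: (h DMt) => Cht; rewrite !inE //; [left | right].
- by apply: (unary_not_preserves (c := DMt) Ch); rewrite !inE.
- by apply: (unary_not_preserves (c := DMt) Ch); rewrite !inE.
Qed.

(** Treats [K3] ([c = DMn]) and [P3] ([c = DMb]) at once: [conflation c] is the only element outside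
    the chain. *)
Lemma not_preserves_chain3 c : c \notin B2 ->
  (exists n (f : dmfun n), C n f /\ ~ preserves f [set DMt; c; DMf]) <->
  [\/ in_C (fun=> conflation c),
      in_C (fun x => if x == c then conflation c else x) | in_C conflation].
Proof.
move=> cB2; split; last first.
  (* All three maps send [c] to [conflation c]. *)
  by case=> Ch; apply: (unary_not_preserves (c := c) Ch); move: cB2;
    rewrite !inE ?eqxx ?orbT //; case: c Ch.
(* The constant [c] need not be in [C], so the identity stands in for it. *)
pose u a y := if a == c then y else a.
have Cu a : a \in [set DMt; c; DMf] -> in_C (u a).
  rewrite !inE /u; case: (a =P c) => [_ _|_]; first exact: in_C_id.
  by rewrite orbF => aB2; apply: in_C_constB2; rewrite !inE.
case/(not_preserves_unary (c := c) Cu) => [a|h Ch hc]; first by rewrite /u; case: eqP.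
have {}hc : h c = conflation c.
  by move: hc cB2; rewrite !inE; case: (h c); case: (c).
(* Either [h a] is already [conflation c], or [h a = c] and a second application of [h] gives it. *)
have ChB2 a : a \in B2 -> h a \notin B2 -> in_C (fun=> conflation c).
  move=> aB2; have Cha : in_C (fun=> h a) := in_C_comp Ch (in_C_constB2 aB2).
  have : in_C (fun=> h (h a)) := in_C_comp Ch Cha.
  have [-> | ha_c] := eqVneq (h a) c; first by rewrite hc.
  move=> _ haB2; suff <- : h a = conflation c by [].
  by move: ha_c haB2 cB2; rewrite !inE; case: (h a); case: (c).
have [htB2|] := boolP (h DMt \in B2); last first.
  by move/ChB2; rewrite !inE => /(_ isT); constructor 1.
have [hfB2|] := boolP (h DMf \in B2); last first.
  by move/ChB2; rewrite !inE => /(_ isT); constructor 1.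
have Ck := in_C_join Ch (in_C_neg Ch).
have Cg := in_C_join (in_C_meet Ck in_C_id) (in_C_neg Ck).
(* Let [d = conflation c]. If [h d = c], then [k d = c] and the term is [(c /\ d) \/ c = c];
   otherwise [k d] is [d] or [DMt], and the term is [d]. *)
have [hd | hd] := eqVneq (h (conflation c)) c; [constructor 3|constructor 2].
  apply: eq_in_C Cg; move: htB2 hfB2 cB2 hc hd; rewrite !inE.
  by case: (c) => //= ht hf _ hn hb; case; rewrite ?hn ?hb //=;
    move: ht hf; case: (h DMt); case: (h DMf).
apply: eq_in_C Cg; move: htB2 hfB2 cB2 hc hd; rewrite !inE.
by case: (c) => //= ht hf _ hn hb; case; rewrite ?hn //=;
  move: ht hf hb; case: (h DMt) => //; case: (h DMf) => //;
  case: (h DMb) => //; case: (h DMn).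
Qed.

End CloneAboveDMA.

Theorem mainTheorem7 (C : dmset) (C_clone : is_clone C)
    (DMA_sub_C : dmset_sub DMA C) :
  [/\ (exists (n : nat) (f : dmfun n), C n f /\ ~ preserves f B2) <->
        (C 0 (dmconst DMn) \/ C 0 (dmconst DMb)),
      (exists (n : nat) (f : dmfun n), C n f /\ ~ preserves f K3) <->
        [\/ C 0 (dmconst DMb), C 0 (dmfun1 id_n_to_b) | C 0 (dmfun1 conflation)]
    & (exists (n : nat) (f : dmfun n), C n f /\ ~ preserves f P3) <->
        [\/ C 0 (dmconst DMn), C 0 (dmfun1 id_b_to_n) | C 0 (dmfun1 conflation)]].
Proof.
split; first exact: not_preserves_B2.
- by apply: (not_preserves_chain3 C_clone DMA_sub_C (c := DMn)); rewrite !inE.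
- by apply: (not_preserves_chain3 C_clone DMA_sub_C (c := DMb)); rewrite !inE.
Qed.
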